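(* Let $p$ be a prime and for $n\ge 0$ let $$H_n(x_1,\dots,x_{n+1})=\prod_{i=1}^n(1+x_i+x_{i+1}),$$ regarded as a polynomial over $\mathbb{F}_p$. Let $N(H_n)$ be the number of nonzero coefficients of $H_n$ (as a polynomial over $\mathbb{F}_p$). Then $$\sum_{n=0}^{\infty}N(H_n)z^n=\frac{1-z^p}{(1-z)^2-z(1-z^p)}.$$
   Context: The empty product is $1$, so $H_0=1$. The identity is one of formal power series in $z$. *)

(* Defs.v *)
From mathcomp Require Import all_boot all_order all_algebra.
From mathcomp Require Import mpoly.

Set Implicit Arguments.
Unset Strict Implicit.
Unset Printing Implicit Defensive.

Import GRing.Theory.
Local Open Scope ring_scope.

(* A formal power series is its coefficient sequence; equality of series is
   coefficientwise equality [=1]. *)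
Definition fps (R : Type) := nat -> R.

Definition fps_of_poly (R : nzRingType) (a : {poly R}) : fps R := fun n => a`_n.

Definition fps_mul (R : nzRingType) (f g : fps R) : fps R :=
  fun n => \sum_(i < n.+1) f i * g (n - i)%N.

(* Quotient of power series by long division, for a denominator g whose
   constant coefficient g 0 is a unit: q_n is obtained from q_0, ..., q_(n-1)
   by solving \sum_(i <= n) q_i * g_(n - i) = f_n.  See [fps_divK] and
   [fps_div_uniq]. *)
Fixpoint fps_div_seq (R : comUnitRingType) (f g : fps R) (n : nat) : seq R :=
  if n is m.+1 then
    let q := fps_div_seq f g m in
    rcons q ((f m - \sum_(i < m) q`_i * g (m - i)%N) / g 0%N)
  else [::].

Definition fps_div (R : comUnitRingType) (f g : fps R) : fps R :=
  fun n => (fps_div_seq f g n.+1)`_n.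

Section FpsDiv.

Variable R : comUnitRingType.
Implicit Types f g h : fps R.

Lemma size_fps_div_seq f g n : size (fps_div_seq f g n) = n.
Proof. by elim: n => //= n IHn; rewrite size_rcons IHn. Qed.

Lemma nth_fps_div_seq f g n i :
  (i < n)%N -> (fps_div_seq f g n)`_i = fps_div f g i.
Proof.
elim: n => // n IHn; rewrite ltnS leq_eqVlt => /predU1P[-> // | lt_in] /=.
by rewrite nth_rcons size_fps_div_seq lt_in IHn.
Qed.

Lemma fps_divE f g n :
  fps_div f g n
  = (f n - \sum_(i < n) fps_div f g i * g (n - i)%N) / g 0%N.
Proof.
rewrite {1}/fps_div /= nth_rcons size_fps_div_seq ltnn eqxx.
by congr ((_ - _) / _); apply: eq_bigr => i _; rewrite nth_fps_div_seq.
Qed.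

Lemma fps_divK f g :
  g 0%N \is a GRing.unit -> fps_mul (fps_div f g) g =1 f.
Proof.
move=> Ug n; rewrite /fps_mul big_ord_recr /= subnn fps_divE divrK //.
by rewrite addrC subrK.
Qed.

Lemma fps_div_uniq f g h :
  g 0%N \is a GRing.unit -> fps_mul h g =1 f -> h =1 fps_div f g.
Proof.
move=> Ug hg_f n; elim/ltn_ind: n => n IHn.
rewrite fps_divE -hg_f /fps_mul big_ord_recr /= subnn.
under [X in _ - X]eq_bigr => i _ do rewrite -IHn //.
by rewrite addrC addrK mulrK.
Qed.

End FpsDiv.

(* The variables x_1, ..., x_(n+1) are 'X_0, ..., 'X_n: for i : 'I_n, both
   [widen_ord (leqnSn n) i] and [lift ord0 i] are in 'I_n.+1, with values i
   and i.+1. *)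
Definition H (R : comNzRingType) (n : nat) : {mpoly R[n.+1]} :=
  \prod_(i < n) (1 + 'X_(widen_ord (leqnSn n) i) + 'X_(lift ord0 i)).

(* [msupp P] lists without repetition the monomials with nonzero coefficient. *)
Definition N (R : nzRingType) (k : nat) (P : {mpoly R[k]}) : nat :=
  size (msupp P).

(* Main.v *)
Require Import Defs.
From mathcomp Require Import all_boot all_order all_algebra.
From mathcomp Require Import mpoly.
From mathcomp Require Import zify ring.

Set Implicit Arguments.
Unset Strict Implicit.
Unset Printing Implicit Defensive.

Import GRing.Theory.
Local Open Scope ring_scope.

(** Regard [H_n * (a + b x_(n+1))] as a polynomial in [x_(n+1)]: for [n+1] in
    place of [n], only the powers 0, 1, 2 of the last variable occur, and their
    coefficients are the same kind of polynomial [H_n * (a' + b' x_(n+1))] with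
    (a', b') = (a, a), (a + b, b), (b, 0) respectively.  Up to scaling, the
    pairs reached from (1, 0) are (1, 0) and (k, 1) with [k] in [F_p].  From
    (k, 1) the transitions lead to (1, 1), (k + 1, 1) and (1, 0), except that
    the first one dies when [k = 0]; so (0, 1) behaves like (1, 0), and
    following the chain (1, 1), (2, 1), ..., (p, 1) = (0, 1) gives a linear
    recurrence of order [p + 1] for [N(H_n)], which is the one encoded by the
    denominator 1 - 3z + z^2 + z^(p+1). *)

Section Support.

Variable R : nzRingType.

Lemma msupp_mwiden n (P : {mpoly R[n]}) :
  perm_eq (msupp (mwiden P)) [seq mnmwiden m | m <- msupp P].
Proof.
have -> : mwiden P = \sum_(m <- msupp P) P@_m *: 'X_[mnmwiden m].
  rewrite {1}[P]mpolyE raddf_sum /=; apply: eq_bigr => m _.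
  by rewrite mwidenZ mwidenX.
have msuppF m : m \in msupp P ->
    msupp (P@_m *: 'X_[mnmwiden m] : {mpoly R[n.+1]}) = [:: mnmwiden m].
  by rewrite mcoeff_msupp => ?; rewrite msuppMCX.
apply: (perm_trans (msupp_sum _ _ _)) => //.
  move=> m m' sm sm' /negP ne_mm' k /=; rewrite !msuppF // !inE.
  by apply/andP=> -[/eqP-> /eqP/inj_mnmwiden/eqP].
rewrite filter_predT -[X in perm_eq _ X]flatten_seq1 -map_comp.
suff -> : [seq msupp (P@_m *: 'X_[mnmwiden m] : {mpoly R[n.+1]}) | m <- msupp P]
    = [seq [:: mnmwiden m] | m <- msupp P] by [].
by apply/eq_in_map => m sm; rewrite msuppF.
Qed.

Lemma N0 n : N (0 : {mpoly R[n]}) = 0%N.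
Proof. by rewrite /N msupp0. Qed.

(** The [k]-th summand has exponent exactly [k] in the last variable, so the supports are disjoint
    and no coefficients cancel. *)
Lemma N_mwiden_sum n d (P : 'I_d -> {mpoly R[n]}) :
  N (\sum_(k < d) mwiden (P k) * 'X_ord_max ^+ k) = (\sum_(k < d) N (P k))%N.
Proof.
have suppF (k : 'I_d) : perm_eq (msupp (mwiden (P k) * 'X_ord_max ^+ k))
    [seq (U_(ord_max) *+ k + mnmwiden m)%MM | m <- msupp (P k)].
  rewrite mpolyXn (perm_trans (msuppMX _ _)) //.
  by rewrite (perm_trans (perm_map _ (msupp_mwiden _))) // -map_comp.
have suppF_max k m : m \in msupp (mwiden (P k) * 'X_ord_max ^+ k) ->
    m ord_max = k :> nat.
  rewrite (perm_mem (suppF k)) => /mapP[m' _ ->].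
  by rewrite mnmDE mulmnE mnm1E eqxx mnmwiden_ordmax mul1n addn0.
rewrite /N (perm_size (msupp_sum _ _ _)) ?index_enum_uniq //.
  rewrite size_flatten /shape -map_comp filter_predT sumnE big_map.
  by apply: eq_bigr => k _ /=; rewrite (perm_size (suppF k)) size_map.
move=> k k' _ _ /eqP ne_kk' m /=; apply/andP=> -[/suppF_max mk /suppF_max mk'].
by case: ne_kk'; apply: val_inj; rewrite /= -mk -mk'.
Qed.

End Support.

Lemma NZ (R : idomainType) n (c : R) (P : {mpoly R[n]}) :
  c != 0 -> N (c *: P) = N P.
Proof. by move=> nz_c; apply/perm_size/msuppZ. Qed.

Definition Hlin (R : comNzRingType) (n : nat) (a b : R) : {mpoly R[n.+1]} :=
  H R n * (a%:MP + b%:MP * 'X_ord_max).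

Section Transfer.

Variable R : comNzRingType.
Implicit Types a b c : R.

Lemma HlinZ n c a b : Hlin n (c * a) (c * b) = c *: Hlin n a b.
Proof. by rewrite /Hlin -mul_mpolyC !mpolyCM; ring. Qed.

Lemma Hlin10 n : Hlin n 1 0 = H R n.
Proof. by rewrite /Hlin mpolyC0 mul0r addr0 mulr1. Qed.

Lemma Hlin00 n : Hlin n 0 0 = 0 :> {mpoly R[n.+1]}.
Proof. by rewrite /Hlin mpolyC0 mul0r addr0 mulr0. Qed.

Lemma H0 : H R 0 = 1.
Proof. by rewrite /H big_ord0. Qed.

Lemma HS n :
  H R n.+1 = mwiden (H R n) * (1 + mwiden 'X_ord_max + 'X_ord_max).
Proof.
rewrite /H big_ord_recr rmorph_prod /=; congr (_ * _).
  apply: eq_bigr => i _; rewrite !rmorphD rmorph1 /= !mwidenX !mnmwiden1.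
  by congr (_ + 'X_ _ + 'X_ _); apply: val_inj.
by rewrite mwidenX mnmwiden1; congr (_ + _ + 'X_ _); apply: val_inj.
Qed.

Lemma N_HlinS n a b :
  N (Hlin n.+1 a b) = (N (Hlin n a a) + N (Hlin n (a + b) b) + N (Hlin n b 0))%N.
Proof.
pose P := [tuple Hlin n a a; Hlin n (a + b) b; Hlin n b 0].
have -> : Hlin n.+1 a b = \sum_(k < 3) mwiden (tnth P k) * 'X_ord_max ^+ k.
  rewrite !big_ord_recl big_ord0 /= !(tnth_nth 0) /= /bump /= /Hlin HS.
  rewrite !rmorphM !rmorphD /= !rmorphM /= !mwidenC mpolyC0.
  by ring.
by rewrite N_mwiden_sum !big_ord_recl big_ord0 !(tnth_nth 0) /= addn0 addnA.
Qed.

Lemma N_Hlin0 a b : N (Hlin 0 a b) = ((a != 0)%R + (b != 0)%R)%N.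
Proof.
pose P := [tuple a%:MP; b%:MP : {mpoly R[0]}].
have -> : Hlin 0 a b = \sum_(k < 2) mwiden (tnth P k) * 'X_ord_max ^+ k.
  rewrite !big_ord_recl big_ord0 /= !(tnth_nth 0) /= /bump /= /Hlin H0 !mwidenC.
  by ring.
rewrite N_mwiden_sum !big_ord_recl big_ord0 !(tnth_nth 0) addn0 /N !msuppC.
by do 2!case: eqP.
Qed.

End Transfer.

(** Both (0, 1) and (1, 0) lead to (1, 1), (1, 0) and the vanishing pair (0, 0), only in a different
    order. *)
Lemma N_Hlin01 (R : comNzRingType) n : N (Hlin n (0 : R) 1) = N (H R n).
Proof.
case: n => [|n]; rewrite -Hlin10; first by rewrite !N_Hlin0 eqxx oner_eq0.
by rewrite !N_HlinS !Hlin00 N0 addn0 add0r addr0.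
Qed.

Section Recurrence.

Variables (p : nat) (p_prime : prime p).

Let F n := N (H 'F_p n).

(* [-j] stands for the residue [p - j], so that [chain p.-1] is the pair (1, 1)
   and [chain 0] the pair (0, 1). *)
Let chain j n := N (Hlin n (- j%:R : 'F_p) 1).

Lemma natFp_neq0 j : (0 < j < p)%N -> (j%:R : 'F_p) != 0.
Proof.
by move=> j_p; rewrite -(dvdn_pcharf (pchar_Fp p_prime)) gtnNdvd; lia.
Qed.

Lemma pred_natFp : - (p.-1)%:R = 1 :> 'F_p.
Proof.
apply/eqP; rewrite eq_sym -addr_eq0 -mulrS prednK ?prime_gt0 //.
by rewrite pchar_Fp_0.
Qed.

Lemma N_H0 : F 0 = 1%N.
Proof. by rewrite /F -Hlin10 N_Hlin0 eqxx oner_eq0. Qed.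

Lemma N_HS n : F n.+1 = (F n + chain p.-1 n)%N.
Proof.
by rewrite /F /chain pred_natFp -!Hlin10 N_HlinS Hlin00 N0 addn0 addr0 addnC.
Qed.

Lemma chain_at0 j : (0 < j < p)%N -> chain j 0 = 2.
Proof. by move=> j_p; rewrite /chain N_Hlin0 oppr_eq0 natFp_neq0 ?oner_eq0. Qed.

Lemma N_H1 : F 1 = 3.
Proof.
rewrite N_HS N_H0 chain_at0 //; have := prime_gt1 p_prime; lia.
Qed.

Lemma chainS j n : (j.+1 < p)%N -> chain j.+1 n.+1 = (F n.+1 + chain j n)%N.
Proof.
move=> j_p; rewrite N_HS /chain N_HlinS pred_natFp Hlin10 mulrSr opprD addrNK.
set c := _ - 1; have nz_c : c != 0 by rewrite /c -opprD -mulrSr oppr_eq0 natFp_neq0.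
(* The successor (c, c) is [c] times (1, 1); by [N_HS] its count and that of (1, 0) add up to
   [F n.+1]. *)
by rewrite -{1 2}[c]mulr1 HlinZ NZ // -/(F n) addnC addnA.
Qed.

(** Induction down the chain: [chainS] lowers [j] and [n] together until [chain 0], which is [F], or
    [n = 0] is reached. The [if] stands for [F (n - j)] extended to negative indices by 1 at -1 and
    0 below. *)
Lemma chain_step j n : (j < p)%N ->
  (chain j n.+1 + (if (j <= n)%N then F (n - j) else (j == n.+1)))%N
  = (chain j n + F n.+1)%N.
Proof.
elim: j n => [|j IHj] [|n] j_p.
- by rewrite /chain oppr0 !N_Hlin01 addnC.
- by rewrite /chain oppr0 !N_Hlin01 subn0 addnC.
- rewrite chainS // (chain_at0 (j := j.+1)) ?j_p //=.
  (* The indicator arises here: [chain 0 0] is 1, whereas every later [chain j 0] is 2. *)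
  case: j j_p {IHj} => [_|j j_p]; last by rewrite chain_at0 ?(ltnW j_p) //=; lia.
  by rewrite /chain oppr0 N_Hlin01 -/(F 0) N_H0; lia.
by rewrite !chainS // subSS ltnS eqSS -addnA IHj 1?ltnW //; lia.
Qed.

(** This is [chain_step] at [j = p.-1], where [N_HS] turns [chain p.-1] into a difference of
    consecutive values of [F]. The indicator of [p = n.+2] matches the term -z^p of the
    numerator. *)
Lemma N_H_rec n :
  (F n.+2 + F n + (if (p <= n.+1)%N then F (n.+1 - p) else (p == n.+2)))%N
  = (3 * F n.+1)%N.
Proof.
have p_gt0 := prime_gt0 p_prime.
have /chain_step-/(_ n) : (p.-1 < p)%N by rewrite prednK.
have -> : (p.-1 <= n)%N = (p <= n.+1)%N by lia.
have -> : (p.-1 == n.+1) = (p == n.+2) by lia.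
have -> : (n - p.-1 = n.+1 - p)%N by lia.
rewrite (N_HS n.+1) (N_HS n); lia.
Qed.
End Recurrence.

Lemma fps_mul_of_poly (R : nzRingType) (f : fps R) (D : {poly R}) n :
  fps_mul f (fps_of_poly D) n = ((\poly_(i < n.+1) f i) * D)`_n.
Proof. by rewrite coefM; apply: eq_bigr => i _; rewrite coef_poly ltn_ord. Qed.

Theorem theorem3p2 (p : nat) (p_prime : prime p) :
  (fun n : nat => (N (H 'F_p n))%:Z)
  =1 fps_div
       (fps_of_poly (1 - 'X^p : {poly int}))
       (fps_of_poly ((1 - 'X) ^+ 2 - 'X * (1 - 'X^p) : {poly int})).
Proof.
have p_gt1 := prime_gt1 p_prime.
have -> : (1 - 'X) ^+ 2 - 'X * (1 - 'X^p)
    = 1 - 'X *+ 3 + 'X^2 + 'X^(p.+1) :> {poly int} by rewrite (exprS _ p); ring.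
apply: fps_div_uniq.
  by rewrite /fps_of_poly !(coefD, coefN, coefMn, coefX, coefXn, coef1).
move=> n; rewrite fps_mul_of_poly /fps_of_poly.
rewrite !mulrDr mulr1 mulrN mulrnAr.
rewrite !(coefD, coefN, coefMn, coefMX, coefMXn, coefXn, coef1, coef_poly).
(* The recurrence governs coefficients from index 2 on; the first two are checked directly, using
   [p > 1]. *)
case: n => [|[|n]] /=.
- by rewrite N_H0 (ltn_eqF (ltnW p_gt1)).
- by rewrite N_H0 N_H1 // (ltn_eqF p_gt1) ltnS prime_gt0.
have rec := N_H_rec p_prime n.
rewrite !ltnS !subSS subn0 leqnn (leqW (leqW (leqnn n))) !leqW //; last by lia.
rewrite eq_sym; case: ltnP rec => p_n; first by case: eqP => _ /=; lia.
by rewrite ltn_eqF //=; lia.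
Qed.
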